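(* There is a constant $c$ such that for every finite field $\mathbb{F}_q$, $\widehat{S}(\mathrm{BW}_{G_q})\le c$; that is, $\widehat{S}(\mathrm{BW}_{G_q})=O(1)$.
   Context: For $(i,j)\in\mathbb{F}_q^2$ let $\ell_{(i,j)}=\{(t,i+jt):t\in\mathbb{F}_q\}$. $G_q$ is the bipartite graph with parts $A=B=\mathbb{F}_q^2$ in which $a\in A$ is adjacent to $b\in B$ iff $a\in\ell_b$. For $x\subseteq A$, $\mathrm{N}(x)\subseteq B$ is its neighbourhood. $\mathrm{BW}_{G_q}:\{0,1\}^A\times\{0,1\}^B\to\{0,1\}$ (a Boolean function on $n=2q^2$ variables) treats $x,y$ as subsets and equals $1$ iff $\mathrm{N}(x)\cap y\neq\emptyset$. For $f:\{0,1\}^n\to\{0,1\}$ and $D\subseteq[n]$, $f_D$ is the matrix with rows indexed by $\alpha\in\{0,1\}^D$, columns by assignments to the complement, entry the value of $f$; $\mathsf{mult}(f_D)$ is the number of occurrences of a most frequent row; $\widehat{S}(f)=\max_{1\le k\le n}\min_{|D|=k}2^k/\mathsf{mult}(f_D)$. *)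

(* Defs.v *)
From HB Require Import structures.
From mathcomp Require Import all_boot all_order all_algebra.
Set Implicit Arguments.
Unset Strict Implicit.
Unset Printing Implicit Defensive.
Import Order.TTheory GRing.Theory Num.Theory.

Local Open Scope ring_scope.

(* The variables of a Boolean function are indexed by an arbitrary finite type
   I, so that n = #|I|. *)

Definition assignment (I : finType) (D : {set I}) : finType :=
  {ffun {i : I | i \in D} -> bool}.

Definition glue (I : finType) (D : {set I})
    (alpha : assignment D) (beta : assignment (~: D)) : {ffun I -> bool} :=
  [ffun i => if insub i is Some j then alpha j
             else if insub i is Some j then beta j
             else false (* unreachable: i lies in D or in ~: D *)].

(* The entry of the matrix f_D in row alpha and column beta. *)
Definition submat (I : finType) (f : {ffun I -> bool} -> bool) (D : {set I})
    (alpha : assignment D) (beta : assignment (~: D)) : bool :=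
  f (glue alpha beta).

Definition submat_row (I : finType) (f : {ffun I -> bool} -> bool)
    (D : {set I}) (alpha : assignment D) : {ffun assignment (~: D) -> bool} :=
  [ffun beta => submat f alpha beta].

Definition mult (I : finType) (f : {ffun I -> bool} -> bool) (D : {set I}) :
    nat :=
  \max_(alpha : assignment D)
     #|[set alpha' : assignment D | submat_row f alpha' == submat_row f alpha]|.

(* Every ratio is positive and at most 2 ^ k, since 1 <= mult f D.  Hence the
   default value 2 ^ k does not affect the minimum (over a nonempty range, as
   k <= #|I|), nor does the default value 0 affect the maximum when I is
   nonempty. *)
Definition Shat (I : finType) (f : {ffun I -> bool} -> bool) : rat :=
  \big[Num.max/0]_(1 <= k < #|I|.+1)
     \big[Num.min/2%:R ^+ k]_(D : {set I} | #|D| == k)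
        (2%:R ^+ k / (mult f D)%:R).

(* A bipartite graph with parts A and B is given by its adjacency relation. *)

Definition nbhd (A B : finType) (adj : A -> B -> bool) (x : {set A}) :
    {set B} :=
  [set b | [exists a in x, adj a b]].

(* {0,1}^A * {0,1}^B is encoded as {0,1}^(A + B). *)
Definition BW (A B : finType) (adj : A -> B -> bool)
    (v : {ffun A + B -> bool}) : bool :=
  let x := [set a : A | v (inl a)] in
  let y := [set b : B | v (inr b)] in
  nbhd adj x :&: y != set0.

Definition line (F : finFieldType) (b : F * F) : {set F * F} :=
  [set (t, b.1 + b.2 * t) | t : F].

Definition line_graph (F : finFieldType) (a b : F * F) : bool := a \in line b.

(* Main.v *)
(** A pair of adjacent points [a], [b] is a certificate: as soon as [a] lies in
    [x] and [b] in [y], the function equals 1.  If [D] contains such a pair, a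
    quarter of the assignments of [D] set both variables to 1, and all of those
    have the same (constant 1) row; hence the ratio is at most 4 for [k >= 2],
    and it is at most [2 ^ k] anyway. *)
Require Import Defs.
From mathcomp Require Import all_boot all_order all_algebra.
Set Implicit Arguments.
Unset Strict Implicit.
Unset Printing Implicit Defensive.
Import Order.TTheory GRing.Theory Num.Theory.
Local Open Scope ring_scope.

(** Each further entry of [s] at most halves the set of admissible functions. Repeated entries do no
    harm, as only a lower bound is claimed. *)
Lemma card_ffun_all_true (T : finType) (s : seq T) :
  (2 ^ #|T| <= 2 ^ size s * #|[set g : {ffun T -> bool} | all g s]|)%N.
Proof.
elim: s => [|i s IHs] /=.
  by rewrite mul1n -[2%N]card_bool -card_ffun cardsE subset_leq_card //; apply/subsetP.
apply: leq_trans IHs _; rewrite expnS -mulnA [(2 * _)%N]mulnC -mulnA leq_mul2l.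
apply/orP; right.
pose S := [set g : {ffun T -> bool} | all g s].
pose S1 := [set g : {ffun T -> bool} | g i && all g s].
pose set_true (g : {ffun T -> bool}) := [ffun j => (j == i) || g j].
(* Functions that are true along [s] but false at [i] inject into [S1] by switching the value at [i]
   to true. *)
have S0_le : (#|S :\: S1| <= #|S1|)%N.
  have set_true_inj : {in S :\: S1 &, injective set_true}.
    move=> g h; rewrite !inE => /andP[/[swap] gs]; rewrite gs andbT => /negPf gi.
    move=> /andP[/[swap] hs]; rewrite hs andbT => /negPf hi.
    move=> /ffunP eq_gh; apply/ffunP => j; have := eq_gh j; rewrite !ffunE.
    by case: eqP => // ->; rewrite gi hi.
  rewrite -(card_in_imset set_true_inj) subset_leq_card //.
  apply/subsetP => _ /imsetP[g + ->]; rewrite !inE => /andP[_ /allP gs].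
  rewrite ffunE eqxx; apply/allP => j js; rewrite ffunE gs ?orbT //.
rewrite -/S -/S1 -(cardsID S1 S) muln2 -addnn leq_add //.
by rewrite subset_leq_card // subsetIr.
Qed.

Lemma superset_of_card (T : finType) (S : {set T}) (k : nat) :
  (#|S| <= k <= #|T|)%N -> exists2 D : {set T}, S \subset D & #|D| = k.
Proof.
move=> /andP[leSk lekT].
have /card_geqP[s [s_uniq s_size sS]] : (k - #|S| <= #|~: S|)%N.
  by rewrite leq_subLR cardsC.
exists (S :|: [set x in s]); first exact: subsetUl.
rewrite cardsU (_ : _ :&: _ = set0) ?cards0 ?subn0.
  by rewrite cardsE (card_uniqP s_uniq) s_size subnKC.
apply/setP => x; rewrite !inE; apply/negP => /andP[xS /sS].
by rewrite inE xS.
Qed.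

Lemma mult_gt0 (I : finType) (f : {ffun I -> bool} -> bool) (D : {set I}) :
  (0 < mult f D)%N.
Proof.
pose alpha : assignment D := [ffun=> false].
rewrite /mult; apply: (leq_trans _ (leq_bigmax alpha)); apply/card_gt0P.
by exists alpha; rewrite inE.
Qed.

(** All assignments of [D] that are true on [S] have the constant true row, and they form at least a
    [2 ^ #|S|]-th of all assignments. *)
Lemma mult_certificate (I : finType) (f : {ffun I -> bool} -> bool)
    (S D : {set I}) :
  (forall v : {ffun I -> bool}, {in S, forall i, v i} -> f v) ->
  S \subset D -> (2 ^ #|D| <= 2 ^ #|S| * mult f D)%N.
Proof.
move=> fS /subsetP SD.
pose s : seq {i : I | i \in D} := pmap insub (enum S).
have s_size : size s = #|S|.
  rewrite size_pmap_sub cardE; apply/eqP; rewrite -all_count.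
  by apply/allP => i; rewrite mem_enum; apply: SD.
have s_row (g : assignment D) : all g s -> submat_row f g = [ffun=> true].
  move=> /allP gs; apply/ffunP => beta; rewrite !ffunE; apply: fS => i iS.
  rewrite ffunE insubT ?SD // => iD; apply: gs.
  by rewrite mem_pmap_sub mem_enum.
have -> : #|D| = #|{: {i : I | i \in D}}| by rewrite card_sig.
apply: leq_trans (card_ffun_all_true s) _; rewrite s_size leq_mul2l.
apply/orP; right.
(* [top] is true on [S], so its row represents the constant true class in the maximum. *)
pose top : assignment D := [ffun=> true].
rewrite /mult; apply: (leq_trans _ (leq_bigmax top)); apply/subset_leq_card/subsetP => g.
rewrite !inE => /s_row ->; rewrite s_row //.
by apply/allP => i _; rewrite ffunE.
Qed.

Lemma Shat_certificate (I : finType) (f : {ffun I -> bool} -> bool)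
    (S : {set I}) :
  (forall v : {ffun I -> bool}, {in S, forall i, v i} -> f v) ->
  Shat f <= 2%:R ^+ #|S|.
Proof.
move=> fS; rewrite /Shat big_nat_cond; apply: bigmax_le.
  by rewrite exprn_ge0.
move=> k /andP[/andP[_]]; rewrite ltnS => lekI _.
have [leSk|/ltnW lekS] := leqP #|S| k; last first.
  (* For [k < #|S|] no [D] can contain [S]; the default value [2 ^ k] of the minimum is already
     small enough. *)
  apply: le_trans (bigmin_le_id _ _ _ _) _.
  by rewrite ler_weXn2l ?ler1n.
have [D SD Dk] : exists2 D : {set I}, S \subset D & #|D| = k.
  by apply: superset_of_card; rewrite leSk.
apply: le_trans (bigmin_le_cond _ (j := D) _ _) _; first exact/eqP.
rewrite ler_pdivrMr ?ltr0n ?mult_gt0 // -!natrX -natrM ler_nat -{1}Dk.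
exact: mult_certificate.
Qed.

Theorem theorem6p6 :
  exists c : rat, forall F : finFieldType, Shat (BW (@line_graph F)) <= c.
Proof.
exists (2%:R ^+ 2) => F.
(* Over every field the origin lies on the line with parameters [(0, 0)], so [o] serves both as
   point and as line, and the two-element certificate gives the uniform constant 4. *)
pose o : F * F := (0, 0).
have o_adj : line_graph o o.
  by apply/imsetP; exists 0; rewrite //= mulr0 addr0.
pose S : {set F * F + F * F} := [set inl o; inr o].
have S_card : #|S| = 2%N by rewrite cards2.
rewrite -[X in _ ^+ X]S_card; apply: Shat_certificate => v vS; apply/set0Pn; exists o.
rewrite !inE vS ?inE ?eqxx ?orbT // andbT.
by apply/existsP; exists o; rewrite o_adj inE vS ?inE ?eqxx.
Qed.
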